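(* Assume that $(\Sigma,T)$ is topologically transitive, that $(\Sigma\times X,\widehat F)$ admits weak unstable holonomies and $\widehat\varphi$-holonomies, and that $\mu$ is uniformly $\widehat\varphi$-expanding on average with constant $\chi>0$. For $\beta>0$ let $\widehat\phi=\widehat\phi_\beta:=\psi-\beta\widehat\varphi$, i.e. $\widehat\phi_\beta(\omega,t)=\psi(\omega)-\beta\widehat\varphi(\omega,t)$. Then $$\widehat P(\widehat\phi_\beta)\le-\beta(\chi-O(\beta)),$$ that is, there are constants $K>0$ and $\beta_0>0$ such that $\widehat P(\psi-\beta\widehat\varphi)\le-\beta(\chi-K\beta)$ for all $\beta\in(0,\beta_0)$.
   Context: Setting: $\Sigma$ is a two-sided compact (finite alphabet) topological Markov shift with left shift $T$; $X$ is a compact metric space; $\omega\mapsto F_\omega$ is a Hölder continuous map from $\Sigma$ into the space $C_\alpha(X,X)$ of $\alpha$-Hölder maps of $X$, each $F_\omega$ an $\alpha$-Hölder homeomorphism; $\widehat F(\omega,t)=(T\omega,F_\omega(t))$; $F^k_\omega=F_{T^{k-1}\omega}\circ\cdots\circ F_\omega$. $\widehat\varphi:\Sigma\times X\to\mathbb R$ is Hölder continuous, and for a function $\widehat g$ on $\Sigma\times X$, $\widehat g^{(n)}:=\sum_{k=0}^{n-1}\widehat g\circ\widehat F^k$. (The motivating case: $M$ a closed Riemannian manifold of dimension $\ge2$, $\omega\mapsto f_\omega\in\mathrm{Diff}^{1+\alpha}(M)$ Hölder, $X=T^1M$, $F_\omega(x,\xi)=(f_\omega(x),d_xf_\omega\xi/|d_xf_\omega\xi|)$,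 $\widehat\varphi(\omega,(x,\xi))=\log|d_xf_\omega\xi|$.) $\mu$ is a $T$-invariant Gibbs probability measure on $\Sigma$ for a Hölder potential $\psi$, normalized so that: $P(\psi)=0$ ($P$ the usual topological/Gurevich pressure); $\psi(\omega)$ depends only on $(\omega_i)_{i\le-1}$; and $L_\psi1=1$, where $(L_\psi g)(\omega^-)=\sum_{T_R\tau^-=\omega^-}e^{\psi(\tau^-)}g(\tau^-)$ on $C(\Sigma^-)$, $\Sigma^-=\{(\omega_i)_{i\le-1}:\omega\in\Sigma\}$ and $T_R$ is the right shift, which deletes the coordinate at position $-1$. For $\omega^-\in\Sigma^-$, $\mu_{\omega^-}$ is the conditional measure of $\mu$ on $V^u_{\le-1}(\omega^-)=\{\omega\in\Sigma:\omega_i=\omega^-_i\ \forall i\le-1\}$ (defined for every $\omega^-$ by $\mu_{\omega^-}([w_0,\dots,w_{n-1}])=\prod_{k=1}^{n}e^{\psi(\omega^-w_0\cdots w_{k-1})}$ for admissible continuations). Uniform $\widehat\varphi$-expansion on average with constant $\chi>0$: for every $\omega^-\in\Sigma^-$, $\inf_{t\in X}\int\widehat\varphi(\omega,t)\,d\mu_{\omega^-}(\omega)\ge\chi$. $\widehat\varphi$-holonomies: there is $C>0$ such that for all $n\ge0$, $t\in X$ and $\omega,\omega'\in\Sigma$ with $\omega_i=\omega'_i$ for $0\le i\le n$, $|\widehat\varphi^{(n)}(\omega,t)-\widehat\varphi^{(n)}(\omega',t)|\le C$. Weak unstable holonomies: $\sup_{t\in X}\ \sup_{\omega,\omega'\in\Sigma:\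 \omega_i=\omega'_i\,\forall i\le-1}d\big(F^j_{T^{-j}\omega}(t),F^j_{T^{-j}\omega'}(t)\big)\to0$ as $j\to\infty$. Pressure out of equilibrium: $\widehat P(\widehat\phi):=\limsup_{n\to\infty}\sup_{t\in X}\frac1n\log\sum_{|\underline w|=n}e^{\widehat\phi^{(n)}(\theta_{\underline w},t)}$, where the sum is over admissible words $\underline w$ of length $n$ and $\theta_{\underline w}=\theta_{\underline w}(t)$ maximizes $\omega\mapsto\widehat\phi^{(n)}(\omega,t)$ on the cylinder $[\underline w]=\{\omega:\omega_i=w_i,\ 0\le i\le n-1\}$. *)

(* Defs.v *)
From HB Require Import structures.
From mathcomp Require Import all_boot all_order all_algebra.
From mathcomp Require Import all_classical all_reals all_analysis.
Set Implicit Arguments.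
Unset Strict Implicit.
Unset Printing Implicit Defensive.
Import Order.TTheory GRing.Theory Num.Theory.
Import numFieldNormedType.Exports.
Local Open Scope classical_set_scope.
Local Open Scope ring_scope.

(* A transition matrix on a finite alphabet whose two-sided shift is nonempty.
   The base point only witnesses nonemptiness: the library requires measurable
   spaces to be pointed. *)
Record markovShift := MarkovShift {
  alphabet :> finType ;
  allowed : rel alphabet ;
  base_seq : int -> alphabet ;
  base_seqP : forall i, allowed (base_seq i) (base_seq (i + 1)) }.

Section Shift.
Variable S : markovShift.

Record Sigma := MkSigma {
  coord :> int -> S ;
  _ : `[< forall i, allowed (coord i) (coord (i + 1)) >] }.

HB.instance Definition _ := [isSub for coord].
HB.instance Definition _ := [Equality of Sigma by <:].
HB.instance Definition _ := [Choice of Sigma by <:].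

Lemma coordP (w : Sigma) i : allowed (w i) (w (i + 1)).
Proof. by case: w => f /= /asboolP. Qed.

Definition base_point : Sigma := MkSigma (asboolT (@base_seqP S)).
HB.instance Definition _ := isPointed.Build Sigma base_point.

Definition coord_prod (w : Sigma) :
  prod_topology (fun _ : int => discrete_topology S) := coord w.
HB.instance Definition _ :=
  Topological.copy Sigma (initial_topology coord_prod).
HB.instance Definition _ :=
  Measurable.copy Sigma (g_sigma_algebraType (@open Sigma)).

Lemma shift_subproof (k : int) (w : Sigma) :
  `[< forall i, allowed (w (i + k)) (w (i + 1 + k)) >].
Proof. by apply/asboolP => i; rewrite addrAC; exact: coordP. Qed.

(* shift_pow k is the k-th power of the left shift, k possibly negative *)
Definition shift_pow (k : int) (w : Sigma) : Sigma :=
  MkSigma (shift_subproof k w).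
Definition shiftT : Sigma -> Sigma := shift_pow 1.

Definition cyl n (u : n.-tuple S) : set Sigma :=
  [set w | forall i : 'I_n, w (i%:Z) = tnth u i].

Definition admissible n (u : n.-tuple S) : bool := `[< cyl u !=set0 >].

Definition word_of (w : Sigma) n : n.-tuple S := [tuple w (i%:Z) | i < n].

(* The entry of index k of a point of SigmaM is its coordinate at position
   -1 - k. *)
Definition past_seq (w : Sigma) : nat -> S := fun k => w (- (k.+1)%:Z).
Definition SigmaM := set_type (range past_seq).

Definition past (w : Sigma) : SigmaM :=
  SigSub (mem_set (imageT past_seq w)).

Lemma TR_subproof (x : SigmaM) :
  (fun k => val x k.+1) \in range past_seq.
Proof.
apply/mem_set; have [w _ xw] := set_mem (valP x).
exists (shift_pow (-1) w) => //; rewrite -xw; apply/funext => k.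
by rewrite /past_seq /= [in RHS]intS opprD addrC.
Qed.

(* T_R deletes the coordinate at position -1. *)
Definition TR (x : SigmaM) : SigmaM := SigSub (TR_subproof x).

Definition Vu (x : SigmaM) : set Sigma := [set w | past w = x].

End Shift.
Arguments past {S} w.
Arguments shiftT {S} w.
Arguments shift_pow {S} k w.

Definition topologically_transitive (Y : topologicalType) (f : Y -> Y) :=
  forall U V : set Y, open U -> open V -> U !=set0 -> V !=set0 ->
    exists n, (iter n f @` U) `&` V !=set0.

Definition homeomorphism (Y Z : topologicalType) (f : Y -> Z) :=
  continuous f /\
  exists g : Z -> Y, [/\ cancel f g, cancel g f & continuous g].

Definition birkhoff (R : realType) (Y : Type) (f : Y -> Y) (g : Y -> R)
  (n : nat) (y : Y) : R := \sum_(k < n) g (iter k f y).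

Section Metric.
Variable R : realType.

Definition holder (U V : Type) (dU : U -> U -> R) (dV : V -> V -> R)
  (a : R) (f : U -> V) :=
  exists C : R, forall x y, dV (f x) (f y) <= C * dU x y `^ a.

Definition holder_continuous (U V : Type) (dU : U -> U -> R)
  (dV : V -> V -> R) (f : U -> V) := exists2 a, 0 < a & holder dU dV a f.

Definition rdist (x y : R) : R := `|x - y|.

(* 2 ^- n for the largest n such that the two sequences agree on |i| < n,
   and 0 if they are equal *)
Definition sdist (S : markovShift) (w w' : Sigma S) : R :=
  inf [set (2^-1 : R) ^+ n |
       n in [set n : nat | forall i : int, (`|i| < n)%N -> w i = w' i]].

Definition pdist (S : markovShift) (X : metricType R) (p q : Sigma S * X) : R :=
  Num.max (sdist p.1 q.1) (mdist p.2 q.2).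

Definition supdist (X : metricType R) (f g : X -> X) : R :=
  sup [set mdist (f t) (g t) | t in [set: X]].

End Metric.
Arguments sdist {R S} w w'.

Section Gibbs.
Variables (R : realType) (S : markovShift).
Local Notation Sigma := (Sigma S).

(* theta g u maximizes g on the cylinder of u (a maximum exists when g is
   continuous and u is admissible). *)
Definition theta (g : Sigma -> R) n (u : n.-tuple S) : Sigma :=
  get [set w | cyl u w /\ forall w', cyl u w' -> g w' <= g w].

Definition partition_sum (g : Sigma -> R) (n : nat) : R :=
  \sum_(u : n.-tuple S | admissible u) expR (g (theta g u)).

Definition pressure (psi : Sigma -> R) : \bar R :=
  limn_esup (fun n =>
    (n%:R^-1 * ln (partition_sum (birkhoff shiftT psi n) n))%:E).

Definition gibbs (mu : probability Sigma R) (psi : Sigma -> R) :=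
  exists2 c : R, 0 < c & forall (w : Sigma) n,
    let e := expR (birkhoff shiftT psi n w - n%:R * fine (pressure psi)) in
    ((c^-1 * e)%:E <= mu (cyl (word_of w n)) <= (c * e)%:E)%E.

Definition shift_invariant (mu : probability Sigma R) :=
  forall B : set Sigma, measurable B -> mu (shiftT @^-1` B) = mu B.

Definition transfer (psi g : SigmaM S -> R) (x : SigmaM S) : R :=
  \sum_(y \in [set y | TR y = x]) expR (psi y) * g y.

(* For w in Vu x, the past of shiftT^k w is the concatenation
   x w_0 ... w_(k-1). *)
Definition unstable_conditionals (mu : probability Sigma R)
  (psi : SigmaM S -> R) (mu_ : SigmaM S -> probability Sigma R) :=
  [/\ forall x, mu_ x (Vu x) = 1%E,
      forall x (w : Sigma) n, Vu x w ->
        mu_ x (cyl (word_of w n)) =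
        (\prod_(1 <= k < n.+1) expR (psi (past (iter k shiftT w))))%:E &
      forall B : set Sigma, measurable B ->
        mu B = (\int[mu]_w mu_ (past w) B)%E].

End Gibbs.

Section SkewProduct.
Variables (R : realType) (S : markovShift) (X : metricType R).
Variable F : Sigma S -> X -> X.

Definition skew_product (p : Sigma S * X) : Sigma S * X :=
  (shiftT p.1, F p.1 p.2).

Fixpoint cocycle (k : nat) (w : Sigma S) (t : X) : X :=
  if k is k'.+1 then F (shift_pow k'%:Z w) (cocycle k' w t) else t.

(* The distance on maps of X is the uniform one: X carries no linear
   structure, and any Hölder-type distance dominates it. *)
Definition holder_cocycle (alpha : R) :=
  [/\ forall w, holder (@mdist R X) (@mdist R X) alpha (F w),
      forall w, homeomorphism (F w) &
      holder_continuous sdist (@supdist R X) F].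

Definition phi_holonomies (phi : Sigma S * X -> R) :=
  exists2 C : R, 0 < C & forall n (t : X) (w w' : Sigma S),
    (forall i : nat, (i <= n)%N -> w i%:Z = w' i%:Z) ->
    `|birkhoff skew_product phi n (w, t) -
      birkhoff skew_product phi n (w', t)| <= C.

Definition weak_unstable_holonomies :=
  (fun j : nat => ereal_sup
     [set (mdist (cocycle j (shift_pow (- j%:Z) p.1.1) p.2)
                 (cocycle j (shift_pow (- j%:Z) p.1.2) p.2))%:E |
      p in [set p : (Sigma S * Sigma S) * X |
            forall i : int, i <= -1 -> p.1.1 i = p.1.2 i]])
  @ \oo --> (0%E : \bar R).

Definition uniform_expansion (mu_ : SigmaM S -> probability (Sigma S) R)
  (phi : Sigma S * X -> R) (chi : R) :=
  forall x : SigmaM S,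
    (chi%:E <= ereal_inf [set \int[mu_ x]_w (phi (w, t))%:E | t in [set: X]])%E.

Definition pressure_out (phi : Sigma S * X -> R) : \bar R :=
  limn_esup (fun n => ereal_sup
    [set (n%:R^-1 *
          ln (partition_sum
                (fun w => birkhoff skew_product phi n (w, t)) n))%:E |
     t in [set: X]]).

End SkewProduct.

(* Main.v *)
Require Import Defs.
From HB Require Import structures.
From mathcomp Require Import all_boot all_order all_algebra.
From mathcomp Require Import zify ring lra.
From mathcomp Require Import all_classical all_reals all_analysis.
Import Order.TTheory GRing.Theory Num.Theory.
Import numFieldNormedType.Exports.
Local Open Scope classical_set_scope.
Local Open Scope ring_scope.

(* Fix a past x and condition mu_x on the first n letters. The weak unstable
   holonomies make F^n_w(t) almost a function of these letters, so the expected
   value of phi(T^n w, F^n_w t) is at least chi - o(1) by uniform expansion at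
   the shifted past. The Birkhoff sums S_n themselves depend on the whole
   future, but by the phi-holonomies they stay at bounded distance from their
   conditional expectations M_n. Hence M_n has bounded increments and drift at
   least chi - o(1), which gives
   E[exp(-beta M_n)] <= exp(-n beta (chi - O(beta)))
   with no multiplicative loss per step. Bounded distortion of psi, up to o(n),
   compares the partition sum with finitely many such expectations, one for each
   first letter. *)

(** * The shift space *)

Section ShiftSpace.
Context {S : markovShift}.
Implicit Types (w : Sigma S).

Lemma eq_Sigma w w' : (forall i, w i = w' i) -> w = w'.
Proof. by move=> ww'; apply/val_inj/funext. Qed.

Lemma iter_shiftT k w : iter k shiftT w = shift_pow k%:Z w.
Proof.
elim: k => [|k IH]; apply: eq_Sigma => i /=; first by rewrite addr0.
by rewrite IH /= -addrA -intS.
Qed.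

Lemma shift_powD a b w : shift_pow a (shift_pow b w) = shift_pow (a + b) w.
Proof. by apply: eq_Sigma => i /=; rewrite addrA. Qed.

Lemma shift_pow0 w : shift_pow 0 w = w.
Proof. by apply: eq_Sigma => i /=; rewrite addr0. Qed.

Lemma shift_powKN a w : shift_pow a (shift_pow (- a) w) = w.
Proof. by rewrite shift_powD subrr shift_pow0. Qed.

Lemma shift_powNK a w : shift_pow (- a) (shift_pow a w) = w.
Proof. by rewrite shift_powD addNr shift_pow0. Qed.

Lemma pastP w w' : past w = past w' <-> forall i : int, i <= -1 -> w i = w' i.
Proof.
split=> [/(congr1 val) /= ww' i ile|ww'].
  have -> : i = - (absz i).-1.+1%:Z by lia.
  exact: (congr1 (@^~ (absz i).-1) ww').
apply: val_inj => /=; apply/funext => k; apply: ww'; lia.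
Qed.

Lemma past_surj (x : SigmaM S) : exists w, past w = x.
Proof. by have [w _ wx] := set_mem (valP x); exists w; exact: val_inj. Qed.

Lemma nbhs_coord w i : nbhs w [set w' : Sigma S | w' i = w i].
Proof.
rewrite nbhsE; exists [set w' : Sigma S | w' i = w i] => //; split => //.
exists ((fun f : prod_topology (fun _ : int => discrete_topology S) => f i)
  @^-1` [set w i]) => //.
apply: open_comp; last exact: discrete_open.
by move=> f _; exact: (@proj_continuous int (fun=> discrete_topology S)).
Qed.

Lemma nbhs_window w m :
  nbhs w [set w' : Sigma S | forall i : int, (`|i| < m)%N -> w' i = w i].
Proof.
elim: m => [|m IH]; first by apply: filterS filterT => w' _ i; rewrite ltn0.
apply: filterS (filterI IH
  (filterI (nbhs_coord w m%:Z) (nbhs_coord w (- m%:Z)))).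
move=> w' [/= ww' [w1 w2]] i im.
have [{}im|mi] := ltnP `|i| m; first exact: ww'.
by have /orP[/eqP->|/eqP->] : (i == m%:Z) || (i == - m%:Z) by lia.
Qed.

Lemma open_coord i (a : S) : open [set w : Sigma S | w i = a].
Proof.
by rewrite openE => w <-; exact: nbhs_coord.
Qed.


(** By Tychonoff the image of the filter has a cluster point [f] in the full product. Fixing
    coordinates [i] and [i + 1] of [f] gives a neighbourhood, which meets the image of the shift;
    hence [f] is allowed at [i]. *)
Lemma compact_Sigma : compact [set: Sigma S].
Proof.
move=> G PG _.
pose P := prod_topology (fun _ : int => discrete_topology S).
have cP : compact [set f : P | forall i, [set: discrete_topology S] (f i)].
  apply: (@tychonoff _ (fun=> discrete_topology S) (fun=> setT)) => i.
  exact: (@finite_compact (discrete_topology S) _ finite_finset).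
have [|f [_ Gf]] := cP (@coord_prod S @ G) _.
  by near=> w.
have fP : `[< forall i, allowed (f i) (f (i + 1)) >].
  apply/asboolP => i.
  have nf j : nbhs (f : P) (fun g => g j = f j).
    rewrite nbhsE.
    exists ((fun g : P => g j) @^-1` [set f j]) => //; split => //.
    apply: open_comp; last exact: discrete_open.
    by move=> g _; exact: (@proj_continuous int (fun=> discrete_topology S)).
  have nff : nbhs (f : P)
      ([set g | g i = f i] `&` [set g | g (i + 1) = f (i + 1)]).
    exact: (@filterI P (nbhs (f : P)) _ _ _ (nf i) (nf (i + 1))).
  have Gr : (@coord_prod S @ G) (range (@coord_prod S)).
    by apply: (@filterS _ G _ setT) => [w _|]; [exists w|exact: filterT].
  have [h [[w _ <-] [/= wi wi1]]] := Gf _ _ Gr nff.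
  by rewrite -wi -wi1; exact: coordP.
exists (MkSigma fP); split => // A B GA.
rewrite nbhsE => -[_ [[U oU <-] Uf] UB].
have nU : nbhs (f : P) U by apply: open_nbhs_nbhs; split.
have GA' : (@coord_prod S @ G) (@coord_prod S @` A).
  by apply: (@filterS _ G _ A) => // w Aw; exists w.
have [h [[w Aw <-] Uw]] := Gf _ _ GA' nU.
by exists w; split => //; exact: UB.
Unshelve. all: by end_near. Qed.

Lemma cyl_wordP w n (u : n.-tuple S) : cyl u w <-> word_of w n = u.
Proof.
split=> [wu|<- i]; last by rewrite tnth_mktuple.
by apply: eq_from_tnth => i; rewrite tnth_mktuple.
Qed.

Lemma closed_coord i (a : S) : closed [set w : Sigma S | w i = a].
Proof.
rewrite -openC openE => w wa; rewrite /interior.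
by apply: filterS (nbhs_coord w i) => w' /= ->.
Qed.

Lemma cylE n (u : n.-tuple S) :
  cyl u = \bigcap_(i in [set: 'I_n]) [set w : Sigma S | w i%:Z = tnth u i].
Proof. by apply/seteqP; split=> [w uw i _|w uw i]; exact: uw. Qed.

Lemma closed_cyl n (u : n.-tuple S) : closed (cyl u).
Proof.
by rewrite cylE; apply: closed_bigI => i _; exact: closed_coord.
Qed.

Lemma measurable_coord i (a : S) : measurable [set w : Sigma S | w i = a].
Proof. by apply: sub_sigma_algebra; exact: open_coord. Qed.

Lemma measurable_cyl n (u : n.-tuple S) : measurable (cyl u).
Proof.
rewrite cylE.
by apply: fin_bigcap_measurable => // i _; exact: measurable_coord.
Qed.

Lemma measurable_Vu (x : SigmaM S) : measurable (Vu x).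
Proof.
rewrite (_ : Vu x = \bigcap_k [set w : Sigma S | w (- k.+1%:Z) = val x k]).
  by apply: bigcapT_measurable => k; exact: measurable_coord.
apply/seteqP; split=> [w <- k _ //|w xw].
by apply/val_inj/funext => k; exact: xw.
Qed.

End ShiftSpace.


(** * Hölder functions and continuity *)

Section Holder.
Context {R : realType}.

Section Sdist.
Context {S : markovShift}.
Implicit Types w : Sigma S.

Lemma sdist_has_lbound w w' : has_lbound [set (2^-1 : R) ^+ n |
  n in [set n : nat | forall i : int, (`|i| < n)%N -> w i = w' i]].
Proof. by exists 0 => _ [n _ <-]; rewrite exprn_ge0// invr_ge0. Qed.

Lemma sdist_le w w' n : (forall i : int, (`|i| < n)%N -> w i = w' i) ->
  sdist w w' <= (2^-1 : R) ^+ n.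
Proof. by move=> ww'; apply: ge_inf; [exact: sdist_has_lbound|exists n]. Qed.

Lemma sdist_ge0 w w' : 0 <= sdist w w' :> R.
Proof.
apply: lb_le_inf; first by exists ((2^-1) ^+ 0), 0%N.
by move=> _ [n _ <-]; rewrite exprn_ge0// invr_ge0.
Qed.

Lemma sdist_le1 w w' : sdist w w' <= 1 :> R.
Proof. by rewrite -(expr0 (2^-1)); apply: sdist_le. Qed.

End Sdist.

Lemma exists_half_exp_le (r : R) : 0 < r -> exists n, (2^-1 : R) ^+ n <= r.
Proof.
move=> r0.
have /cvgrPdist_lt /(_ r r0) [n _ /(_ n (leqnn n))] :
    ((fun n => (2^-1 : R) ^+ n) : nat -> R) @ \oo --> (0 : R).
  by apply: cvg_expr; rewrite gtr0_norm ?invr_gt0// invf_lt1// ltr1n.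
by rewrite /= sub0r normrN => h; exists n; rewrite (le_trans (ler_norm _))// ltW.
Qed.

Lemma holder_unif_continuous {U V : Type} {dU : U -> U -> R} {dV : V -> V -> R}
    {f : U -> V} : (forall x y, 0 <= dU x y) -> holder_continuous dU dV f ->
  forall e : R, 0 < e ->
    exists2 r, 0 < r & forall x y, dU x y <= r -> dV (f x) (f y) <= e.
Proof.
move=> dU0 [a a0 [C fC]] e e0.
(* The Hölder constant [C] may be nonpositive, so it is replaced by a positive one before
   dividing. *)
have C0 : 0 < `|C| + 1 by rewrite ltr_wpDl.
have eC : 0 < e / (`|C| + 1) by rewrite divr_gt0.
exists ((e / (`|C| + 1)) `^ a^-1); first exact: powR_gt0.
move=> x y xyr; apply: (le_trans (fC x y)).
have h : dU x y `^ a <= e / (`|C| + 1).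
  have -> : e / (`|C| + 1) = ((e / (`|C| + 1)) `^ a^-1) `^ a.
    by rewrite -powRrM mulVf ?lt0r_neq0// powRr1// ltW.
  by apply: (ge0_ler_powR (ltW a0)) => //; rewrite nnegrE ?dU0 ?powR_ge0.
apply: (@le_trans _ _ ((`|C| + 1) * dU x y `^ a)).
  rewrite ler_wpM2r ?powR_ge0// (le_trans (ler_norm _))// lerDl.
  exact: ler01.
by rewrite mulrC -ler_pdivlMr.
Qed.

Lemma holder_bounded {U : Type} {dU : U -> U -> R} {f : U -> R} D :
  (forall x y, 0 <= dU x y <= D) -> holder_continuous dU (@rdist R) f ->
  exists2 B, 0 < B & forall x, `|f x| <= B.
Proof.
move=> dUD [a a0 [C fC]].
have [[x0 _]|nU] := pselect (exists x : U, True); last first.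
  by exists 1 => // x; case: nU; exists x.
exists (`|f x0| + `|C| * D `^ a + 1) => [|x].
  by rewrite ltr_wpDl// addr_ge0// mulr_ge0// powR_ge0.
have /andP[d0 dD] := dUD x x0.
have : `|f x - f x0| <= `|C| * D `^ a.
  apply: (le_trans (fC x x0)); apply: (@le_trans _ _ (`|C| * dU x x0 `^ a)).
    by rewrite ler_wpM2r ?powR_ge0// ler_norm.
  rewrite ler_wpM2l//.
    by apply: (ge0_ler_powR (ltW a0)) => //; rewrite nnegrE// (le_trans d0).
have := ler_distD 0 (f x) (f x0); have := lerB_dist (f x) (f x0); lra.
Qed.

Lemma holder_window {S : markovShift} {f : Sigma S -> R} :
  holder_continuous sdist (@rdist R) f -> forall e : R, 0 < e ->
  exists n, forall w w' : Sigma S,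
    (forall i : int, (`|i| < n)%N -> w i = w' i) -> `|f w - f w'| <= e.
Proof.
move=> fh e e0.
have [r r0 fr] := holder_unif_continuous sdist_ge0 fh e e0.
have [n nr] := exists_half_exp_le _ r0.
by exists n => w w' /sdist_le/le_trans-/(_ _ nr); exact: fr.
Qed.

Section CompactMetric.
Context {X : metricType R} (cX : compact [set: X]).

(** The distance to a fixed point attains a maximum, and twice this maximum bounds the diameter. *)
Lemma compact_mdist_bounded : exists D, forall s t : X, 0 <= mdist s t <= D.
Proof.
have [[t0 _]|nX] := pselect (exists t : X, True); last first.
  by exists 0 => x; case: nX; exists x.
have cont : continuous (mdist t0 : X -> R).
  move=> t; apply/cvgrPdist_lt => e e0; near=> s.
  have ts : mdist t s < e.
    near: s; have := nbhsx_ballx t e e0.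
    by apply: filterS => s; rewrite ballEmdist.
  have := metric_triangle t0 t s; have := metric_triangle t0 s t.
  by rewrite (metric_sym s t) ltr_norml; lra.
have [||t _ tmax] := @compact_EVT_max X R (mdist t0) setT _ cX.
- by exists t0.
- exact: continuous_subspaceT.
exists (mdist t0 t + mdist t0 t) => x y; rewrite mdist_ge0/=.
rewrite (le_trans (metric_triangle x t0 y))// (metric_sym x t0) lerD//.
- by apply: tmax; rewrite inE.
- by apply: tmax; rewrite inE.
Unshelve. all: by end_near. Qed.

(** [sup] is meaningful only on a bounded set; compactness of [X] provides the bound. *)
Lemma le_supdist (f g : X -> X) t : mdist (f t) (g t) <= supdist f g.
Proof.
have [D XD] := compact_mdist_bounded.
apply: ub_le_sup; last by exists t.
by exists D => _ [s _ <-]; have /andP[] := XD (f s) (g s).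
Qed.

Lemma pdist_ge0 {S : markovShift} (p q : Sigma S * X) : 0 <= pdist p q.
Proof. by rewrite /pdist le_max sdist_ge0. Qed.

Lemma pdist_bounded {S : markovShift} :
  exists D, forall p q : Sigma S * X, 0 <= pdist p q <= D.
Proof.
have [D XD] := compact_mdist_bounded.
exists (Num.max 1 D) => p q; rewrite pdist_ge0 /pdist ge_max !le_max sdist_le1/=.
by have /andP[_ ->] := XD p.2 q.2; rewrite orbT.
Qed.

End CompactMetric.
End Holder.


(** * Continuity of Birkhoff sums and maximizers on cylinders *)

Section Observables.
Context {R : realType} {S : markovShift}.

Lemma window_continuous (g : Sigma S -> R) :
  (forall (w : Sigma S) (e : R), 0 < e -> exists m, forall w' : Sigma S,
    (forall i : int, (`|i| < m)%N -> w' i = w i) -> `|g w' - g w| <= e) ->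
  continuous g.
Proof.
move=> gw w; apply/(@cvgrPdist_le R R^o (Sigma S) (nbhs w) (nbhs_filter w)) => e e0.
have [m gm] := gw w e e0.
by apply: (filterS _ (nbhs_window w m)) => w' ww'; rewrite distrC gm.
Qed.

(** [theta] is a [get], hence arbitrary unless a maximizer exists; a nonempty cylinder is compact,
    so the extreme value theorem supplies one. *)
Lemma theta_maximizes (g : Sigma S -> R) n (u : n.-tuple S) :
  continuous g -> admissible u ->
  cyl u (theta g u) /\ forall w', cyl u w' -> g w' <= g (theta g u).
Proof.
move=> gc /asboolP u0.
have cu : compact (cyl u).
  exact: (subclosed_compact (closed_cyl _ u) compact_Sigma).
have [w wu wmax] := compact_EVT_max u0 cu (continuous_subspaceT gc).
apply: (@getPex _ [set w | cyl u w /\ forall w', cyl u w' -> g w' <= g w]).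
exists w; split; first by rewrite inE in wu.
by move=> w' w'u; apply: wmax; rewrite inE.
Qed.

Context {X : metricType R} (cX : compact [set: X]).
Context {alpha : R} (alpha0 : 0 < alpha).
Context {F : Sigma S -> X -> X} (Fh : holder_cocycle F alpha).

Lemma iter_skew_product k w t :
  iter k (skew_product F) (w, t) = (shift_pow k%:Z w, cocycle F k w t).
Proof.
elim: k => [|k IH] /=; first by rewrite shift_pow0.
by rewrite IH /skew_product /= /shiftT shift_powD.
Qed.

Lemma cocycle_window k t (w : Sigma S) (e : R) : 0 < e ->
  exists m, forall w' : Sigma S,
  (forall i : int, (`|i| < m)%N -> w' i = w i) ->
  mdist (cocycle F k w' t) (cocycle F k w t) <= e.
Proof.
elim: k e => [|k IH] e e0; first by exists 0%N => w' _; rewrite mdistxx ltW.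
have [Fw _ Fs] := Fh.
have e20 : 0 < e / 2 by rewrite divr_gt0.
have [r r0 sr] := holder_unif_continuous sdist_ge0 Fs _ e20.
have [n nr] := exists_half_exp_le _ r0.
have Fhc : holder_continuous (@mdist R X) (@mdist R X) (F (shift_pow k%:Z w)).
  by exists alpha.
have [r' r'0 Fr'] := holder_unif_continuous (@mdist_ge0 R X) Fhc _ e20.
have [m wm] := IH r' r'0.
exists (maxn m (n + k)) => w' ww' /=.
set c' := cocycle F k w' t; set c := cocycle F k w t.
(* First the base point of the outer map changes, at cost [supdist], then the argument under the
   fixed outer map. The base point is shifted by [k], hence the window [n + k]. *)
apply: (le_trans (metric_triangle _ (F (shift_pow k%:Z w) c') _)).
rewrite [leRHS]splitr lerD//.
  apply: (le_trans (le_supdist cX _ _ _)); apply: sr.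
  apply: le_trans nr; apply: sdist_le => i im /=; apply: ww'; lia.
by apply: Fr'; apply: wm => i im; apply: ww'; rewrite leq_max im.
Qed.

(** Assuming only a modulus of continuity lets this apply to psi - beta phi, whose two terms may
    have different Hölder exponents. *)
Lemma continuous_birkhoff (Phi : Sigma S * X -> R) n t :
  (forall e : R, 0 < e -> exists2 r, 0 < r & forall p q, pdist p q <= r ->
    `|Phi p - Phi q| <= e) ->
  continuous (fun w => birkhoff (skew_product F) Phi n (w, t)).
Proof.
move=> Phic; elim: n => [|n IH].
  rewrite (_ : (fun _ => _) = fun=> 0); first exact: cst_continuous.
  by apply/funext => w; rewrite /birkhoff big_ord0.
rewrite (_ : (fun _ => _) = fun w => birkhoff (skew_product F) Phi n (w, t)
    + Phi (iter n (skew_product F) (w, t))); last first.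
  by apply/funext => w; rewrite /birkhoff big_ord_recr.
move=> w; apply: (@cvgD R R^o _ _ (nbhs_filter w)); first exact: (IH w).
move: w; apply: window_continuous => w e e0.
have [r r0 Pr] := Phic e e0.
have [m mr] := exists_half_exp_le _ r0.
have [m' wm'] := cocycle_window n t w r r0.
exists (maxn m' (m + n)) => w' ww'; rewrite !iter_skew_product.
apply: Pr; rewrite /pdist/= ge_max wm' ?andbT; last first.
  by move=> i im; apply: ww'; rewrite leq_max im.
apply: le_trans mr; apply: sdist_le => i im /=; apply: ww'; lia.
Qed.

End Observables.


(** * Conditional measures *)

Section FinitelyValuedBound.
Context {R : realType} {d : measure_display} {T : measurableType d}.
Variable P : probability T R.

(** On the full-measure set [V], [h] is dominated by the step function [c] of [W], whose integral is
    a finite sum. This turns the expansion hypothesis into a statement on words. *)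
Lemma integral_le_finitely_valued (I : finType) (W : T -> I) (V : set T)
  (h : T -> R) (c : I -> R) B :
  measurable V -> P V = 1%E ->
  (forall i, measurable (W @^-1` [set i])) -> measurable_fun setT h ->
  (forall w, `|h w| <= B) -> (forall w, V w -> h w <= c (W w)) ->
  (\int[P]_w (h w)%:E <=
   (\sum_i c i * fine (P (W @^-1` [set i] `&` V)))%:E)%E.
Proof.
move=> mV PV mW mh hB hc.
have hint : P.-integrable setT (EFin \o h).
  apply: measurable_bounded_integrable => //.
    by apply: (@le_lt_trans _ _ 1%E); [exact: probability_le1|exact: ltry].
  exists B; split => [|M BM w _]; first exact: num_real.
  exact: le_trans (hB w) (ltW BM).
pose g i w := ((c i)%:E * (\1_(W @^-1` [set i]) w)%:E)%E : \bar R.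
have iint i : P.-integrable V (fun w => (\1_(W @^-1` [set i]) w)%:E).
  by apply: (integrableS measurableT) => //; exact: integrable_indic.
have gint i : P.-integrable V (g i) by exact: integrableZl.
have gE w : (c (W w))%:E = (\sum_i g i w)%E.
  rewrite (bigD1 (W w))//= big1 ?adde0.
    by rewrite /g indicE mem_set// mule1.
  move=> i iW; rewrite /g indicE memNset ?mule0// => /= /esym/eqP.
  by rewrite (negbTE iW).
have -> : (\int[P]_w (h w)%:E = \int[P]_(w in V) (h w)%:E)%E.
  rewrite (negligible_integral (N := ~` V) _ _ hint)//; last 2 first.
  - exact: measurableC.
  - by apply: etrans (probability_setC P mV) _; rewrite PV subee.
  by rewrite setDE setCK setTI.
apply: (@le_trans _ _ (\int[P]_(w in V) (\sum_i g i w))%E).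
  apply: le_integral => //.
  - exact: (integrableS measurableT).
  - exact: integrable_sum.
  - by move=> w; rewrite inE => Vw; rewrite -gE lee_fin hc.
rewrite integral_sum// -sumEFin; apply: lee_sum => i _.
rewrite integralZl// integral_indic// EFinM fineK//.
by apply: fin_num_measure; exact: measurableI.
Qed.

End FinitelyValuedBound.

Lemma continuous_measurable_Sigma {R : realType} {S : markovShift}
  (g : Sigma S -> R) : continuous g -> measurable_fun setT g.
Proof.
move=> /continuousP gc.
apply: (measurability _ (measurable_realfun.RGenOInfty.measurableE R)).
move=> _ [_ [a ->] <-]; rewrite setTI; apply: sub_sigma_algebra.
by apply: gc; exact: (@interval_open R).
Qed.


Lemma measure_setI_full {R : realType} {d : measure_display}
  {T : measurableType d} (P : probability T R) (A V : set T) :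
  measurable A -> measurable V -> P V = 1%E -> P (A `&` V) = P A.
Proof.
move=> mA mV PV; apply/eqP; rewrite eq_le; apply/andP; split.
  by apply: le_measure; rewrite ?inE//; exact: measurableI.
have PVC : P (~` V) = 0%E.
  by apply: etrans (probability_setC P mV) _; rewrite PV subee.
rewrite -[leRHS]adde0 -[in leRHS]PVC.
apply: (@le_trans _ _ (P ((A `&` V) `|` ~` V))).
  apply: le_measure; rewrite ?inE//.
    by apply: measurableU; [exact: measurableI|exact: measurableC].
  by move=> w Aw; have [Vw|Vw] := pselect (V w); [left|right].
by apply: measureU2; [exact: measurableI|exact: measurableC].
Qed.

(** * Laws of words under the conditional measures *)

Section Words.
Context {R : realType} {S : markovShift}.

Lemma word_ofE (w : Sigma S) N :
  word_of w N = [seq w i%:Z | i <- iota 0 N] :> seq S.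
Proof.
apply: (@eq_from_nth _ (w 0)) => [|i]; first by rewrite size_tuple size_map size_iota.
rewrite size_tuple => iN.
rewrite (nth_map 0%N) ?size_iota// nth_iota// add0n.
by rewrite -[i]/(nat_of_ord (Ordinal iN)) -tnth_nth tnth_mktuple.
Qed.

Lemma take_word_of (w w' : Sigma S) {n N} : (n <= N)%N ->
  take n (word_of w N) = take n (word_of w' N) <->
  forall i, (i < n)%N -> w i%:Z = w' i%:Z.
Proof.
move=> nN; rewrite !word_ofE -!map_take take_iota (minn_idPl nN).
split=> [ww' i ni|ww'].
  have := congr1 (fun s => nth (w 0) s i) ww'.
  by rewrite !(nth_map 0%N) ?size_iota// nth_iota.
by apply/eq_in_map => i; rewrite mem_iota => /andP[_]; exact: ww'.
Qed.

Lemma eq_word_of (w w' : Sigma S) N : word_of w N = word_of w' N <->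
  forall i, (i < N)%N -> w i%:Z = w' i%:Z.
Proof.
rewrite -(take_word_of w w' (leqnn N)) !take_oversize ?size_tuple//.
by split=> [->//|/val_inj].
Qed.

Definition continues (x : SigmaM S) {n} (u : n.-tuple S) : Prop :=
  exists w, Vu x w /\ cyl u w.

(** Evaluating at this point turns functions on the shift into functions of words. It is arbitrary
    when [u] cannot follow [x], where [weight] vanishes. *)
Definition rep (x : SigmaM S) {n} (u : n.-tuple S) : Sigma S :=
  get [set w | Vu x w /\ cyl u w].

Lemma repP {x n} {u : n.-tuple S} :
  continues x u -> Vu x (rep x u) /\ cyl u (rep x u).
Proof. exact: getPex. Qed.

Lemma continues_word_of {x} n {w : Sigma S} :
  Vu x w -> continues x (word_of w n).
Proof. by move=> xw; exists w; split => //; apply/cyl_wordP. Qed.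

Lemma past_shift_eq n (w w' : Sigma S) : past w = past w' ->
  (forall i, (i < n)%N -> w i%:Z = w' i%:Z) ->
  past (shift_pow n%:Z w) = past (shift_pow n%:Z w').
Proof.
move=> /pastP pww ww'; apply/pastP => i ile /=.
have [i0|i0] := leP 0 (i + n%:Z); last by apply: pww; lia.
have -> : i + n%:Z = (absz (i + n%:Z))%:Z by lia.
by apply: ww'; lia.
Qed.

Variables (psi : SigmaM S -> R) (mu_ : SigmaM S -> probability (Sigma S) R).
Hypothesis mu_Vu : forall x, mu_ x (Vu x) = 1%E.
Hypothesis mu_cyl : forall x (w : Sigma S) n, Vu x w ->
  mu_ x (cyl (word_of w n)) =
  (\prod_(1 <= k < n.+1) expR (psi (past (iter k shiftT w))))%:E.

(** The conditional mass of the [n]-cylinder of [w] given its past. The product starts at 1 because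
    the factor for a letter is [psi] at the past ending with that letter. *)
Definition cyl_mass (w : Sigma S) n : R :=
  \prod_(1 <= k < n.+1) expR (psi (past (iter k shiftT w))).

Lemma cyl_mass_gt0 w n : 0 < cyl_mass w n.
Proof. by apply: prodr_gt0 => i _; exact: expR_gt0. Qed.

Lemma cyl_massD w n m :
  cyl_mass w (n + m) = cyl_mass w n * cyl_mass (shift_pow n%:Z w) m.
Proof.
rewrite /cyl_mass (@big_cat_nat _ _ _ n.+1)//=; last by rewrite ltnS leq_addr.
congr (_ * _); rewrite -[n.+1]add1n big_addn.
have -> : ((n + m).+1 - n = m.+1)%N by lia.
by apply: eq_bigr => k _; rewrite iterD -(iter_shiftT n).
Qed.

Lemma eq_cyl_mass n (w w' : Sigma S) : past w = past w' ->
  (forall i, (i < n)%N -> w i%:Z = w' i%:Z) -> cyl_mass w n = cyl_mass w' n.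
Proof.
move=> pww ww'; rewrite /cyl_mass big_nat [RHS]big_nat.
apply: eq_bigr => k /andP[_ kn]; rewrite !iter_shiftT; congr (expR (psi _)).
by apply: past_shift_eq => // i ik; apply: ww'; lia.
Qed.

(** The law of the first [n] letters under [mu_ x], as a function on all words. *)
Definition weight x {n} (u : n.-tuple S) : R :=
  if `[< continues x u >] then cyl_mass (rep x u) n else 0.

Lemma weight_ge0 x {n} (u : n.-tuple S) : 0 <= weight x u.
Proof. by rewrite /weight; case: ifP => // _; rewrite ltW// cyl_mass_gt0. Qed.

Lemma weight_neq0 x {n} (u : n.-tuple S) : weight x u != 0 -> continues x u.
Proof. by rewrite /weight; case: ifPn => [/asboolP|_ /eqP]. Qed.

Section ConditionalLaw.
Variables (x : SigmaM S) (N n : nat).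
Hypothesis nN : (n <= N)%N.
Variable u0 : N.-tuple S.
Hypothesis xu0 : continues x u0.

Let w0 := rep x u0.
Let y := past (shift_pow n%:Z w0).
Let W (w : Sigma S) := word_of (shift_pow (- n%:Z) w) N.

Let pw0 : past w0 = x. Proof. by have [] := repP xu0. Qed.

Let unshift w : Vu y w -> past (shift_pow (- n%:Z) w) = x /\
  forall i, (i < n)%N -> shift_pow (- n%:Z) w i%:Z = w0 i%:Z.
Proof.
move=> /pastP yw; have e (i : int) : i < n%:Z -> shift_pow (- n%:Z) w i = w0 i.
  by move=> i_n /=; rewrite yw /= ?subrK//; lia.
split; last by move=> i i_n; apply: e; lia.
by rewrite -pw0; apply/pastP => i ile; apply: e; lia.
Qed.

Lemma measurable_W u : measurable (W @^-1` [set u]).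
Proof.
rewrite (_ : _ @^-1` _ = \bigcap_(i in [set: 'I_N])
    [set w : Sigma S | w (i%:Z - n%:Z) = tnth u i]).
  by apply: fin_bigcap_measurable => // i _; exact: measurable_coord.
apply/seteqP; split=> [w <- i _|w wu] /=; first by rewrite tnth_mktuple.
by apply: eq_from_tnth => i; rewrite tnth_mktuple; exact: wu.
Qed.

(* The conditional law of the whole word given its first [n] letters is the law
   of the shifted point under the conditional measure of the shifted past. *)
Lemma weight_conditional u : mu_ y (W @^-1` [set u] `&` Vu y) =
  (if take n u == take n u0 then weight x u / cyl_mass w0 n else 0)%:E.
Proof.
have [_ /cyl_wordP u0E] := repP xu0; rewrite -/w0 in u0E.
case: ifPn => [/eqP uu0|uu0]; last first.
  rewrite (_ : _ `&` _ = set0) ?measure0//; rewrite -subset0 => w [/= Wu yw].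
  have [_ ww0] := unshift _ yw.
  by move/eqP : uu0; apply; rewrite -Wu -u0E; exact/take_word_of.
rewrite /weight; case: ifPn => [/asboolP xu|/asboolP xu]; last first.
  rewrite mul0r (_ : _ `&` _ = set0) ?measure0//; rewrite -subset0 => w [/= Wu yw].
  have [xw _] := unshift _ yw; apply: xu; rewrite -Wu.
  exact: continues_word_of.
have [pwu /cyl_wordP uE] := repP xu; set wu := rep x u in pwu uE *.
have wuw0 i : (i < n)%N -> wu i%:Z = w0 i%:Z.
  by move: i; apply/(take_word_of _ _ nN); rewrite uE u0E.
(* On [Vu y] the unshifted point already has the first [n] letters of [w0], so [W w = u] constrains
   only the other [N - n] letters. *)
rewrite (_ : _ `&` _ = cyl (word_of (shift_pow n%:Z wu) (N - n)) `&` Vu y).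
  rewrite measure_setI_full//; [|exact: measurable_cyl|exact: measurable_Vu].
  rewrite mu_cyl; last by apply: past_shift_eq => //; rewrite pw0.
  rewrite -/(cyl_mass _ _) -{2}(subnKC nN) cyl_massD.
  rewrite (@eq_cyl_mass n wu w0)//; last by rewrite pw0.
  by rewrite mulrAC divff ?mul1r// lt0r_neq0// cyl_mass_gt0.
apply/seteqP; split=> w [/=].
  rewrite -uE => /eq_word_of Ww yw; split => //; apply/cyl_wordP/eq_word_of.
  move=> i iN /=; rewrite -[_ + _]/((i + n)%N%:Z) -Ww /=; last by lia.
  by congr (w _); lia.
move=> /cyl_wordP/eq_word_of Ww yw; split => //=.
rewrite -uE; apply/eq_word_of => i iN.
have [i_n|i_n] := ltnP i n; first by rewrite wuw0//; exact: (unshift _ yw).2.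
rewrite /= (_ : i%:Z - n%:Z = (i - n)%N%:Z); last by lia.
by rewrite Ww/=; [congr (wu _); lia|lia].
Qed.

(** The integral under [mu_ y] is bounded by a finite sum over the values of [W], whose masses are
    given by [weight_conditional]; the factor [cyl_mass w0 n] clears their denominator. *)
Lemma drift_of_integral (h : Sigma S -> R) (c : N.-tuple S -> R) (a B : R) :
  continuous h -> (forall w, `|h w| <= B) ->
  (forall w, Vu x w -> (forall i, (i < n)%N -> w i%:Z = w0 i%:Z) ->
    h (shift_pow n%:Z w) <= c (word_of w N)) ->
  (a%:E <= \int[mu_ y]_w (h w)%:E)%E ->
  a * cyl_mass w0 n <=
    \sum_(u : N.-tuple S | take n u == take n u0) weight x u * c u.
Proof.
move=> hc hB hcw ah; rewrite -ler_pdivlMr ?cyl_mass_gt0//.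
have cW w : Vu y w -> h w <= c (W w).
  move=> yw; have [xw ww0] := unshift _ yw.
  by have := hcw _ xw ww0; rewrite shift_powKN.
have := le_trans ah (@integral_le_finitely_valued _ _ _ (mu_ y) _ W (Vu y) h c B
  (measurable_Vu y) (mu_Vu y) measurable_W
  (continuous_measurable_Sigma _ hc) hB cW).
rewrite lee_fin => /le_trans; apply; rewrite big_distrl/= [leRHS]big_mkcond/=.
apply: ler_sum => u _; rewrite weight_conditional/=.
by case: ifP => _; rewrite ?mulr0// mulrCA mulrA.
Qed.

Lemma sum_weight_conditional :
  \sum_(u : N.-tuple S | take n u == take n u0) weight x u = cyl_mass w0 n.
Proof.
(* The constants 1 and -1 give the two inequalities. *)
have cst_drift (a : R) : a * cyl_mass w0 n <=
    \sum_(u : N.-tuple S | take n u == take n u0) weight x u * a.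
  apply: (@drift_of_integral (fun=> a) (fun=> a) a `|a|) => //.
    exact: cst_continuous.
  rewrite integral_cst//=.
  have -> : (a%:E * mu_ y [set: Sigma S] = a%:E * 1)%E.
    by congr (_ * _)%E; exact: (probability_setT (mu_ y)).
  by rewrite mule1.
apply/eqP; rewrite eq_le; apply/andP; split.
  by have := cst_drift (-1); rewrite -big_distrl/= mulrC !mulrN1 lerN2.
by have := cst_drift 1; rewrite -big_distrl/= mulrC !mulr1.
Qed.

End ConditionalLaw.

Lemma sum_weight x N : \sum_(u : N.-tuple S) weight x u = 1.
Proof.
have [w xw] := past_surj x.
have := @sum_weight_conditional x N 0 (leq0n N) _ (continues_word_of N xw).
under eq_bigl do rewrite !take0 eqxx.
by move=> ->; rewrite /cyl_mass big_geq.
Qed.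

End Words.


(** * Exponential moments *)

(** Compare (1 - x) e^x <= 1 with (1 - x)(1 + x + 2x^2) = 1 + x^2 (1 - 2x). *)
Lemma expR_le_quadratic (R : realType) (x : R) :
  x <= 2^-1 -> expR x <= 1 + x + 2 * x ^+ 2.
Proof.
move=> x12.
have x1 : 0 < 1 - x by lra.
have : 1 - x <= expR (- x) by exact: expR_ge1Dx.
rewrite expRN => ex.
have e0 := expR_gt0 x.
have : (1 - x) * expR x <= 1.
  by rewrite -ler_pdivlMr// mul1r.
move=> h; rewrite -(ler_pM2l x1) (le_trans h)//.
suff : 0 <= x ^+ 2 * (1 - 2 * x) by move=> ?; nra.
by rewrite mulr_ge0 ?sqr_ge0//; lra.
Qed.

Section ConditionalMean.
Context {R : realType} {I : finType} {p : I -> R} (p_ge0 : forall u, 0 <= p u).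

(** Conditional expectation of [g] given [k] under the weights [p]; it is 0 on classes of zero mass,
    since the inverse of 0 is 0. *)
Definition cmean {T : eqType} (k : I -> T) (g : I -> R) (u : I) : R :=
  (\sum_(v | k v == k u) p v * g v) / \sum_(v | k v == k u) p v.

Lemma class_mass_gt0 {T : eqType} (k : I -> T) {u} :
  p u != 0 -> 0 < \sum_(v | k v == k u) p v.
Proof.
move=> pu; rewrite (bigD1 u)//= ltr_pwDl ?sumr_ge0// lt_def pu p_ge0//.
Qed.

(** Exchange the double sum over pairs in the same class: [f] and the class mass are constant there,
    so the inner sum cancels the denominator. *)
Lemma cmean_tower {T : eqType} {k : I -> T} {f} g :
  (forall u v, k u = k v -> f u = f v) ->
  \sum_u p u * (f u * cmean k g u) = \sum_u p u * (f u * g u).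
Proof.
move=> fk; pose m u := \sum_(v | k v == k u) p v.
have mE u v : k v = k u -> m v = m u by rewrite /m => ->.
transitivity (\sum_u \sum_(v | k v == k u) p v * g v * (p u * f u / m u)).
  apply: eq_bigr => u _; rewrite /cmean -/(m u) !mulrA mulrAC big_distrr/=.
  by apply: eq_bigr => v _; rewrite mulrC.
rewrite (exchange_big_dep xpredT)//=; apply: eq_bigr => v _.
rewrite -big_distrr/=; have [->|pv] := eqVneq (p v) 0; first by rewrite !mul0r.
rewrite -mulrA; congr (_ * _); rewrite [RHS]mulrC; congr (_ * _).
transitivity (\sum_(u | k u == k v) p u * (f v / m v)).
  apply: eq_big => [u|u /eqP kvu]; first by rewrite eq_sym.
  by rewrite (mE v u (esym kvu)) (fk v u kvu) mulrA.
rewrite -big_distrl/= -/(m v) mulrCA divff ?mulr1//.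
exact/lt0r_neq0/class_mass_gt0.
Qed.

Lemma cmean_close {T : eqType} (k : I -> T) g {u C} : p u != 0 ->
  (forall v, k v = k u -> p v != 0 -> `|g v - g u| <= C) ->
  `|cmean k g u - g u| <= C.
Proof.
move=> pu gC; have m0 := class_mass_gt0 k pu.
have -> : cmean k g u - g u =
    (\sum_(v | k v == k u) p v * (g v - g u)) / \sum_(v | k v == k u) p v.
  under [in RHS]eq_bigr do rewrite mulrBr.
  by rewrite sumrB -big_distrl/= mulrBl mulrAC divff ?mul1r// lt0r_neq0.
rewrite normrM normfV (gtr0_norm m0) ler_pdivrMr// big_distrr/=.
apply: (le_trans (ler_norm_sum _ _ _)); apply: ler_sum => v /eqP kv.
rewrite normrM ger0_norm//.
have [->|pv] := eqVneq (p v) 0; first by rewrite mul0r mulr0.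
by rewrite mulrC ler_wpM2r// gC.
Qed.

(* Conditionally on [k1], the increment of the conditional means has the same
   mean as [S2 - S1], so a lower bound on the drift of [S2 - S1] gives a
   one-step contraction of the exponential moment. *)
Lemma exp_moment_step (T1 T2 : eqType) (k1 : I -> T1) (k2 : I -> T2)
  (S1 S2 : I -> R) (b c C B : R) :
  (forall u v, k2 u = k2 v -> k1 u = k1 v) ->
  (forall u v, p u != 0 -> p v != 0 -> k1 v = k1 u -> `|S1 v - S1 u| <= C) ->
  (forall u v, p u != 0 -> p v != 0 -> k2 v = k2 u -> `|S2 v - S2 u| <= C) ->
  (forall u, p u != 0 -> `|S2 u - S1 u| <= B) ->
  (forall u, p u != 0 -> c * \sum_(v | k1 v == k1 u) p v <=
    \sum_(v | k1 v == k1 u) p v * (S2 v - S1 v)) ->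
  0 <= b -> b * (2 * C + B) <= 2^-1 ->
  \sum_u p u * expR (- (b * cmean k2 S2 u)) <=
  expR (- (b * c) + 2 * (b * (2 * C + B)) ^+ 2) *
    \sum_u p u * expR (- (b * cmean k1 S1 u)).
Proof.
move=> k21 S1C S2C S21 drift b0 bD.
set D := 2 * C + B in bD *.
pose f u := expR (- (b * cmean k1 S1 u)).
have fk1 u v : k1 u = k1 v -> f u = f v by rewrite /f /cmean => ->.
have f0 u : 0 < f u by exact: expR_gt0.
(* Replacing each of [S1], [S2] by its mean costs [C], and the increment itself at most [B]. *)
have incr u : p u != 0 -> `|cmean k2 S2 u - cmean k1 S1 u| <= D.
  move=> pu; have c1 := cmean_close k1 S1 pu (fun v kv pv => S1C _ _ pu pv kv).
  have c2 := cmean_close k2 S2 pu (fun v kv pv => S2C _ _ pu pv kv).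
  have := S21 u pu; move: c1 c2; rewrite !ler_norml /D; lra.
(* The quadratic bound on the exponential of the increment. The linear term stays split into two
   products so that the tower property applies to each mean separately. *)
have step u : p u * expR (- (b * cmean k2 S2 u)) <=
    p u * f u * (1 + 2 * (b * D) ^+ 2) -
    b * (p u * (f u * cmean k2 S2 u) - p u * (f u * cmean k1 S1 u)).
  have [->|pu] := eqVneq (p u) 0; first by rewrite !mul0r subrr mulr0 subr0.
  rewrite (_ : - (b * cmean k2 S2 u) = - (b * cmean k1 S1 u)
     + - (b * (cmean k2 S2 u - cmean k1 S1 u))); last by ring.
  rewrite expRD -/(f u); set d := _ - cmean k1 S1 u.
  have /ler_normlP[d1 d2] : `|d| <= D := incr u pu.
  have bd : - (b * d) <= 2^-1.
    by rewrite (le_trans _ bD)// -mulrN ler_wpM2l//.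
  have := expR_le_quadratic _ _ bd.
  have bd2 : (- (b * d)) ^+ 2 <= (b * D) ^+ 2.
    rewrite sqrrN !exprMn ler_wpM2l ?sqr_ge0//.
    by rewrite -[d ^+ 2]real_normK ?num_real// lerXn2r ?nnegrE// ?(le_trans _ (incr u pu)).
  move=> h.
  have {h}h : expR (- (b * d)) <= 1 - b * d + 2 * (b * D) ^+ 2 by lra.
  rewrite (_ : _ - b * _ = p u * (f u * (1 - b * d + 2 * (b * D) ^+ 2))); last first.
    by rewrite /d; ring.
  by rewrite ler_wpM2l// ler_pM2l.
(* [f] depends only on the [k1]-class, so the increment may be replaced by its [k1]-mean, which
   [drift] bounds below by [c]. *)
have driftf : c * (\sum_u p u * f u) <= \sum_u p u * (f u * (S2 u - S1 u)).
  rewrite -(cmean_tower (fun u => S2 u - S1 u) fk1) big_distrr/=; apply: ler_sum => u _.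
  have [->|pu] := eqVneq (p u) 0; first by rewrite !mul0r mulr0.
  rewrite mulrCA ler_wpM2l// mulrC ler_pM2l// /cmean ler_pdivlMr ?class_mass_gt0//.
  exact: drift.
apply: (le_trans (ler_sum _ (fun u _ => step u))).
rewrite sumrB -big_distrr -big_distrl/= sumrB.
rewrite (@cmean_tower _ k1)// (@cmean_tower _ k2); last by move=> u v /k21/fk1.
have -> : \sum_u p u * (f u * S2 u) - \sum_u p u * (f u * S1 u) =
    \sum_u p u * (f u * (S2 u - S1 u)).
  by rewrite -sumrB; apply: eq_bigr => u _; rewrite -mulrBr -mulrBr.
set A := \sum_u p u * f u in driftf *.
have A0 : 0 <= A by apply: sumr_ge0 => u _; rewrite mulr_ge0// ltW.
set E := \sum_u p u * (f u * (S2 u - S1 u)) in driftf *.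
apply: (@le_trans _ _ ((1 + (- (b * c) + 2 * (b * D) ^+ 2)) * A)).
  have : b * (c * A) <= b * E by rewrite ler_wpM2l.
  lra.
by rewrite ler_wpM2r// expR_ge1Dx.
Qed.

End ConditionalMean.


(** * Drift and exponential moments of the Birkhoff sums *)

Section ExponentialMoment.
Context {R : realType} {S : markovShift} {X : metricType R}.
Context (F : Sigma S -> X -> X).

Lemma weak_unstable_holonomies_eventually :
  weak_unstable_holonomies F -> forall r : R, 0 < r ->
  exists n0, forall n, (n0 <= n)%N -> forall (w w' : Sigma S) t,
    past w = past w' ->
    mdist (cocycle F n (shift_pow (- n%:Z) w) t)
      (cocycle F n (shift_pow (- n%:Z) w') t) <= r.
Proof.
move=> Fw r r0.
have rE : (0%E < r%:E)%E by rewrite lte_fin.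
have [n0 _ n0r] := Fw _ (open_nbhs_nbhs (conj (@open_ereal_lt_ereal R r%:E) rE)).
exists n0 => n nn0 w w' t /pastP ww'.
have /= := n0r n nn0; rewrite -lee_fin => /ltW; apply: le_trans.
apply: ereal_sup_ubound; exists ((w, w'), t) => //.
Qed.

Context (phi : Sigma S * X -> R) {B C : R}.
Hypothesis phiB : forall p, `|phi p| <= B.
Hypothesis phi_hol : forall n (t : X) (w w' : Sigma S),
    (forall i : nat, (i <= n)%N -> w i%:Z = w' i%:Z) ->
    `|birkhoff (skew_product F) phi n (w, t) -
      birkhoff (skew_product F) phi n (w', t)| <= C.

(** The holonomy bound for [n] terms asks for agreement on [n + 1] letters. It is applied to one
    term fewer, and the last term costs at most [2 * B]. *)
Lemma birkhoff_cylinder n t (w w' : Sigma S) :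
  (forall i, (i < n)%N -> w i%:Z = w' i%:Z) ->
  `|birkhoff (skew_product F) phi n (w, t) -
      birkhoff (skew_product F) phi n (w', t)| <= C + 2 * B.
Proof.
have C0 : 0 <= C.
  apply: le_trans (phi_hol 0 t w w _) => //.
have B0 : 0 <= B by exact: le_trans (phiB (w, t)).
case: n => [_|n ww'].
  by rewrite /birkhoff !big_ord0 subrr normr0 addr_ge0// mulr_ge0.
have := phi_hol n t w w' (fun i (ni : (i <= n)%N) => ww' i ni).
rewrite /birkhoff !big_ord_recr/=.
set a := \sum_(i < n) _; set b := \sum_(i < n) _.
have := phiB (iter n (skew_product F) (w, t)).
have := phiB (iter n (skew_product F) (w', t)).
rewrite !ler_norml; lra.
Qed.

Variables (psi : SigmaM S -> R) (mu_ : SigmaM S -> probability (Sigma S) R).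
Hypothesis mu_Vu : forall x, mu_ x (Vu x) = 1%E.
Hypothesis mu_cyl : forall x (w : Sigma S) n, Vu x w ->
  mu_ x (cyl (word_of w n)) =
  (\prod_(1 <= k < n.+1) expR (psi (past (iter k shiftT w))))%:E.
Context {chi eta r : R} {n0 n1 : nat}.
Hypothesis phi_cont : forall t, continuous (fun w => phi (w, t)).
Hypothesis expansion : uniform_expansion mu_ phi chi.
Hypothesis phi_r : forall p q, pdist p q <= r -> `|phi p - phi q| <= eta.
Hypothesis n0r : forall n, (n0 <= n)%N -> forall (w w' : Sigma S) t,
    past w = past w' ->
    mdist (cocycle F n (shift_pow (- n%:Z) w) t)
      (cocycle F n (shift_pow (- n%:Z) w') t) <= r.
Hypothesis n1r : (2^-1 : R) ^+ n1 <= r.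

Section FixedWord.
Variables (x : SigmaM S) (t : X) (N : nat).

Let Sn n (u : N.-tuple S) := birkhoff (skew_product F) phi n (rep x u, t).
Let p (u : N.-tuple S) := weight psi x u.

(** Given the first [n] letters, the fibre point at time [n] is within [r] of [t'], and the base
    point is known on a window of radius [n1]. Up to [eta] the increment is thus phi at [t'], whose
    mean is at least [chi] by expansion at the shifted past. *)
Lemma drift_lower_bound n (u0 : N.-tuple S) :
  (n0 <= n)%N -> (n + n1 <= N)%N -> p u0 != 0 ->
  (chi - eta) * \sum_(u : N.-tuple S | take n u == take n u0) p u <=
  \sum_(u : N.-tuple S | take n u == take n u0) p u * (Sn n.+1 u - Sn n u).
Proof.
move=> nn0 nN /weight_neq0 xu0.
have n_N : (n <= N)%N by rewrite (leq_trans (leq_addr _ _) nN).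
set w0 := rep x u0; pose t' := cocycle F n w0 t.
have SnE u : Sn n.+1 u - Sn n u =
    phi (shift_pow n%:Z (rep x u), cocycle F n (rep x u) t).
  by rewrite /Sn /birkhoff big_ord_recr/= iter_skew_product addrAC subrr add0r.
rewrite (@sum_weight_conditional _ _ _ _ mu_Vu mu_cyl _ _ _ n_N _ xu0).
have chi_y : (chi%:E <= \int[mu_ (past (shift_pow n%:Z w0))]_w (phi (w, t'))%:E)%E.
  by apply: (le_trans (expansion _)); apply: ereal_inf_lbound; exists t'.
have step w : Vu x w -> (forall i, (i < n)%N -> w i%:Z = w0 i%:Z) ->
    phi (shift_pow n%:Z w, t') <= Sn n.+1 (word_of w N) - Sn n (word_of w N) + eta.
  move=> xw ww0; rewrite SnE; set w' := rep x (word_of w N).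
  have [xw' /cyl_wordP/eq_word_of w'w] := repP (continues_word_of N xw).
  have w'w0 i : (i < n)%N -> w' i%:Z = w0 i%:Z.
    by move=> i_n; rewrite w'w ?ww0//; lia.
  have [xw0 _] := repP xu0.
  rewrite -lerBlDl (le_trans (ler_norm _))// phi_r// /pdist ge_max/=.
  apply/andP; split.
    apply: le_trans n1r; apply: sdist_le => i i_n1 /=.
    (* Nonnegative positions lie among the [N] known letters because [n + n1 <= N]; negative ones
       belong to the common past [x]. *)
    have [i0|i0] := leP 0 (i + n%:Z).
      have -> : i + n%:Z = (absz (i + n%:Z))%:Z by lia.
      by rewrite w'w//; lia.
    have /pastP : past w = past w' by rewrite xw xw'.
    by apply; lia.
  (* The [n]-th shifts of the two points share their past, since they share [x] and the first [n]
     letters. *)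
  have := n0r _ nn0 (shift_pow n%:Z w0) (shift_pow n%:Z w') t.
  rewrite !shift_powNK; apply.
  by apply: past_shift_eq => [|i i_n]; [rewrite xw0 xw'|rewrite w'w0].
have := @drift_of_integral R S psi mu_ mu_Vu mu_cyl x N n n_N u0 xu0
  (fun w => phi (w, t')) (fun u => Sn n.+1 u - Sn n u + eta) chi B
  (phi_cont t') (fun w => phiB (w, t')) step chi_y.
under eq_bigr do rewrite mulrDr.
rewrite big_split/= -big_distrl/=.
rewrite (@sum_weight_conditional _ _ _ _ mu_Vu mu_cyl _ _ _ n_N _ xu0).
by rewrite -/w0 mulrBl lerBlDr [eta * _]mulrC.
Qed.

Let B_ge0 : 0 <= B. Proof. exact: le_trans (phiB (base_point S, t)). Qed.

Let C_ge0 : 0 <= C.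
Proof. by apply: le_trans (phi_hol 0 t (base_point S) (base_point S) _). Qed.

Let Sn_incr n u : `|Sn n.+1 u - Sn n u| <= B.
Proof. by rewrite /Sn /birkhoff big_ord_recr/= addrAC subrr add0r. Qed.

Let Sn_close n : (n <= N)%N -> forall u v, p u != 0 -> p v != 0 ->
  take n v = take n u -> `|Sn n v - Sn n u| <= C + 2 * B.
Proof.
move=> nN u v /weight_neq0 xu /weight_neq0 xv uv; apply: birkhoff_cylinder.
have [_ /cyl_wordP uE] := repP xu; have [_ /cyl_wordP vE] := repP xv.
by apply/(take_word_of _ _ nN); rewrite uE vE.
Qed.

Let D := 2 * (C + 2 * B) + B.

Let moment (b : R) n :=
  \sum_u p u *
    expR (- (b * cmean (p := p) (fun v : N.-tuple S => take n v) (Sn n) u)).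

Let p_ge0 u : 0 <= p u. Proof. exact: weight_ge0. Qed.

Let moment_step b c n : 0 <= b -> b * D <= 2^-1 -> (n < N)%N ->
  (forall u, p u != 0 ->
    c * \sum_(v : N.-tuple S | take n v == take n u) p v <=
    \sum_(v : N.-tuple S | take n v == take n u) p v * (Sn n.+1 v - Sn n v)) ->
  moment b n.+1 <= expR (- (b * c) + 2 * (b * D) ^+ 2) * moment b n.
Proof.
move=> b0 bD nN drift; apply: (exp_moment_step (p := p)) => //.
- move=> u v uv; have : take n (take n.+1 u) = take n (take n.+1 v) by rewrite uv.
  by rewrite !take_takel.
- by move=> u v pu pv; apply: Sn_close => //; exact: ltnW.
- by move=> u v pu pv; apply: Sn_close.
Qed.

(* The drift bound [chi - eta] fails only at times before [n0] or within [n1] of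
   the horizon; [minn n n0 + (n + n1 - N)] bounds the number of such times. *)
Let moment_bound b n : 0 <= b -> b * D <= 2^-1 -> 0 <= chi -> 0 <= eta ->
  (n <= N)%N ->
  moment b n <= expR (n%:R * (- (b * (chi - eta)) + 2 * (b * D) ^+ 2) +
    (minn n n0 + (n + n1 - N))%:R * (b * (B + chi))).
Proof.
move=> b0 bD chi0 eta0; elim: n => [_|n IH nN].
  rewrite mul0r add0r (@le_trans _ _ 1)//.
    rewrite /moment -(sum_weight _ _ mu_Vu mu_cyl x N); apply: ler_sum => u _.
    rewrite /cmean big1; first by rewrite mul0r mulr0 oppr0 expR0 mulr1.
    by move=> v _; rewrite /Sn /birkhoff big_ord0 mulr0.
  by rewrite -expR0 ler_expR mulr_ge0// mulr_ge0// addr_ge0.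
have {IH}IH := IH (ltnW nN).
have [good|bad] := boolP ((n0 <= n)%N && (n + n1 <= N)%N).
  have /andP[nn0 nn1] := good.
  have drift := moment_step _ _ _ b0 bD nN
    (fun u pu => drift_lower_bound _ _ nn0 nn1 pu).
  apply: (le_trans drift).
  apply: (@le_trans _ _ (expR (- (b * (chi - eta)) + 2 * (b * D) ^+ 2) * expR
   (n%:R * (- (b * (chi - eta)) + 2 * (b * D) ^+ 2) +
    (minn n n0 + (n + n1 - N))%:R * (b * (B + chi))))).
    by rewrite ler_pM2l ?expR_gt0.
  rewrite -expRD ler_expR.
  have : (minn n n0 + (n + n1 - N))%:R * (b * (B + chi)) <=
      (minn n.+1 n0 + (n.+1 + n1 - N))%:R * (b * (B + chi)).
    by rewrite ler_wpM2r ?mulr_ge0// ?addr_ge0// ler_nat; lia.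
  rewrite -(natr1 n); lra.
(* At the exceptional times the drift is at least [- B]; replacing [chi - eta] by it costs at most
   [b * (B + chi)] in the exponent. *)
have crude u : p u != 0 ->
    - B * \sum_(v : N.-tuple S | take n v == take n u) p v <=
    \sum_(v : N.-tuple S | take n v == take n u) p v * (Sn n.+1 v - Sn n v).
  move=> _; rewrite big_distrr/=; apply: ler_sum => v _.
  rewrite mulrC ler_wpM2l//; by have /ler_normlP[] := Sn_incr n v; lra.
apply: (le_trans (moment_step _ _ _ b0 bD nN crude)).
set m := (minn n n0 + _)%N in IH; set m' := (minn n.+1 n0 + _)%N.
have mm' : (m.+1 <= m')%N by rewrite /m /m'; lia.
apply: (@le_trans _ _ (expR (- (b * - B) + 2 * (b * D) ^+ 2) *
   expR (n%:R * (- (b * (chi - eta)) + 2 * (b * D) ^+ 2) +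
     m%:R * (b * (B + chi))))).
  by rewrite ler_pM2l ?expR_gt0.
rewrite -expRD ler_expR.
have bBchi : 0 <= b * (B + chi) by rewrite mulr_ge0// addr_ge0.
have : m.+1%:R * (b * (B + chi)) <= m'%:R * (b * (B + chi)).
  by rewrite ler_wpM2r// ler_nat.
have be : 0 <= b * eta by rewrite mulr_ge0.
rewrite -(natr1 m) -(natr1 n); lra.
Qed.

Lemma exp_moment_bound b : 0 <= b -> b * D <= 2^-1 -> 0 <= chi -> 0 <= eta ->
  \sum_u p u * expR (- (b * Sn N u)) <=
  expR (N%:R * (- (b * (chi - eta)) + 2 * (b * D) ^+ 2) +
    (n0 + n1)%:R * (b * (B + chi))).
Proof.
move=> b0 bD chi0 eta0.
have := moment_bound b N b0 bD chi0 eta0 (leqnn N).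
rewrite (_ : moment b N = \sum_u p u * expR (- (b * Sn N u))).
  move=> /le_trans; apply; rewrite ler_expR lerD2l ler_wpM2r//.
    by rewrite mulr_ge0// addr_ge0.
  by rewrite ler_nat; lia.
apply: eq_bigr => u _; have [->|pu] := eqVneq (p u) 0; first by rewrite !mul0r.
congr (_ * expR (- (b * _))).
(* At time [N] the classes are single words, so the conditional mean is [Sn N] itself. *)
apply/eqP; rewrite -subr_eq0 -normr_eq0 eq_le normr_ge0 andbT.
apply: cmean_close => // v.
rewrite !take_oversize ?size_tuple// => /val_inj -> _.
by rewrite subrr normr0.
Qed.

End FixedWord.
End ExponentialMoment.


(** * Partition sums *)

Section PartitionSum.
Context {R : realType} {S : markovShift}.

(** Only the transition from -1 to 0 mixes the two points, and it is one of [w] because they agree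
    at 0. Hence whether a nonempty word can follow a past depends only on its first letter. *)
Lemma splice (w w' : Sigma S) : w 0 = w' 0 ->
  exists v, past v = past w /\ forall i : nat, v i%:Z = w' i%:Z.
Proof.
move=> ww'0; pose f (i : int) := if i < 0 then w i else w' i.
have fP : `[< forall i, allowed (f i) (f (i + 1)) >].
  apply/asboolP => i; rewrite /f.
  have [i0|i0] := ltP i 0; have [i1|i1] := ltP (i + 1) 0; try exact: coordP.
  - have -> : w' (i + 1) = w (i + 1) by rewrite (_ : i + 1 = 0)//; lia.
    exact: coordP.
  - by lia.
exists (MkSigma fP); split => //; apply/pastP => i ile /=.
by rewrite /f ifT//; lia.
Qed.

Context {psi : SigmaM S -> R} {M eta : R} {m : nat}.
Hypothesis psiM : forall w, `|psi (past w)| <= M.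
Hypothesis psi_m : forall w w' : Sigma S,
  (forall i : int, (`|i| < m)%N -> w i = w' i) ->
  `|psi (past w) - psi (past w')| <= eta.

Let M_ge0 : 0 <= M. Proof. exact: le_trans (psiM (base_point S)). Qed.

Let eta_ge0 : 0 <= eta.
Proof. by apply: le_trans (psi_m (base_point S) (base_point S) _). Qed.

(** The error grows linearly in [N] but with slope [eta]; with [eta] equal to beta^2 it joins the
    quadratic term of the pressure bound. *)
Lemma distortion N (w w' : Sigma S) :
  (forall i, (i < N)%N -> w i%:Z = w' i%:Z) ->
  \sum_(k < N) psi (past (shift_pow k%:Z w)) <=
  \sum_(k < N) psi (past (shift_pow k%:Z w')) +
    (N%:R * eta + (m + m)%:R * (2 * M)).
Proof.
move=> ww'.
(* The window of radius [m] at time [k] fits in the cylinder unless [k < m] or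
   [N < k + m]; [minn n m + (n + m - N)] bounds the number of such [k < n]. *)
have bound n : (n <= N)%N ->
    \sum_(k < n) psi (past (shift_pow k%:Z w)) <=
    \sum_(k < n) psi (past (shift_pow k%:Z w')) +
    (n%:R * eta + (minn n m + (n + m - N))%:R * (2 * M)).
  elim: n => [_|n IH nN].
    by rewrite !big_ord0 mul0r !add0r mulr_ge0// mulr_ge0.
  have {IH}IH := IH (ltnW nN).
  rewrite !big_ord_recr/= -(natr1 n).
  set s := psi (past (shift_pow n%:Z w)).
  set s' := psi (past (shift_pow n%:Z w')).
  have [good|bad] := boolP ((m <= n)%N && (n + m <= N)%N).
    have ss' : s - s' <= eta.
      apply: (le_trans (ler_norm _)); apply: psi_m => i im /=.
      have -> : i + n%:Z = (absz (i + n%:Z))%:Z by lia.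
      by apply: ww'; lia.
    have : (minn n m + (n + m - N))%:R * (2 * M) <=
        (minn n.+1 m + (n.+1 + m - N))%:R * (2 * M).
      by rewrite ler_wpM2r ?mulr_ge0// ler_nat; lia.
    lra.
  have ss' : s - s' <= 2 * M.
    have := psiM (shift_pow n%:Z w); have := psiM (shift_pow n%:Z w').
    by rewrite -/s -/s' !ler_norml; lra.
  set j := (minn n m + _)%N in IH; set j' := (minn n.+1 m + _)%N.
  have : j.+1%:R * (2 * M) <= j'%:R * (2 * M).
    by rewrite ler_wpM2r ?mulr_ge0// ler_nat /j /j'; lia.
  have := eta_ge0; rewrite -(natr1 j); lra.
apply: (le_trans (bound N (leqnn N))); rewrite !lerD2l.
by rewrite ler_wpM2r ?mulr_ge0// ler_nat; lia.
Qed.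

(** The sums run over times 0 to N - 1 and 1 to N, so they differ by two boundary terms, each at
    most [M] in absolute value. *)
Lemma expR_birkhoff_cyl_mass N (w : Sigma S) :
  expR (\sum_(k < N) psi (past (shift_pow k%:Z w))) <=
  expR (2 * M) * cyl_mass psi w N.
Proof.
pose f k := psi (past (shift_pow k%:Z w)).
have -> : cyl_mass psi w N = expR (\sum_(1 <= k < N.+1) f k).
  by rewrite expR_sum; apply: eq_bigr => k _; rewrite iter_shiftT.
rewrite -expRD ler_expR.
have e : \sum_(k < N) f k + f N = f 0%N + \sum_(1 <= k < N.+1) f k.
  by rewrite -[in RHS]big_ltn// big_mkord big_ord_recr.
have := psiM (shift_pow 0%N w); have := psiM (shift_pow N%:Z w).
rewrite -/(f 0%N) -/(f N) !ler_norml -/(\sum_(k < N) f k).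
move: e; set a := \sum_(k < N) f k; set b := \sum_(1 <= k < N.+1) f k; lra.
Qed.

Lemma partition_sum_gt0 (g : Sigma S -> R) n : 0 < partition_sum g n.
Proof.
rewrite /partition_sum (bigD1 (word_of (base_point S) n))/=; last first.
  by apply/asboolP; exists (base_point S); apply/cyl_wordP.
by rewrite ltr_pwDl ?expR_gt0// sumr_ge0// => u _; exact: expR_ge0.
Qed.

Context {X : metricType R} {F : Sigma S -> X -> X} {phi : Sigma S * X -> R}.
Context {B C : R}.
Hypothesis phiB : forall p, `|phi p| <= B.
Hypothesis phi_hol : forall n (t : X) (w w' : Sigma S),
    (forall i : nat, (i <= n)%N -> w i%:Z = w' i%:Z) ->
    `|birkhoff (skew_product F) phi n (w, t) -
      birkhoff (skew_product F) phi n (w', t)| <= C.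

Let Phi b (p : Sigma S * X) : R := psi (past p.1) - b * phi p.

Lemma birkhoff_tilted b n w t : birkhoff (skew_product F) (Phi b) n (w, t) =
  \sum_(k < n) psi (past (shift_pow k%:Z w)) -
  b * birkhoff (skew_product F) phi n (w, t).
Proof.
rewrite /birkhoff big_distrr/= -sumrB; apply: eq_bigr => k _.
by rewrite /Phi iter_skew_product.
Qed.

(* A past that [a] may follow; arbitrary if [a] occurs in no point. *)
Definition past_of_letter (a : S) : SigmaM S :=
  past (get [set w : Sigma S | w 0 = a]).

Lemma continues_past_of_letter n (w : Sigma S) :
  continues (past_of_letter (w 0)) (word_of w n).
Proof.
have g0 : (get [set w' : Sigma S | w' 0 = w 0]) 0 = w 0.
  by apply: (@getPex _ [set w' : Sigma S | w' 0 = w 0]); exists w.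
have [v [pv vw]] := splice _ _ g0; exists v; split => //.
by apply/cyl_wordP/eq_word_of => i _; exact: vw.
Qed.

(** One conditional measure charges only words that can follow its past, so one past per letter is
    used, whence the factor [#|S|]. The exponent adds the distortions of psi and phi and the index
    shift in [cyl_mass]. *)
Lemma partition_sum_le b N t (Z : R) : 0 <= b ->
  continuous (fun w => birkhoff (skew_product F) (Phi b) N (w, t)) ->
  (forall x : SigmaM S, \sum_(u : N.-tuple S) weight psi x u *
    expR (- (b * birkhoff (skew_product F) phi N (rep x u, t))) <= Z) ->
  partition_sum (fun w => birkhoff (skew_product F) (Phi b) N (w, t)) N <=
  #|S|%:R *
    (expR (N%:R * eta + (m + m)%:R * (2 * M) + b * (C + 2 * B) + 2 * M) * Z).
Proof.
move=> b0 gc wZ; set g := fun w => _.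
set K := expR _.
pose q (x : SigmaM S) (u : N.-tuple S) := weight psi x u *
  expR (- (b * birkhoff (skew_product F) phi N (rep x u, t))).
have q0 x u : 0 <= q x u by rewrite mulr_ge0 ?weight_ge0// expR_ge0.
have main u : admissible u -> expR (g (theta g u)) <=
    \sum_(a : S) K * q (past_of_letter a) u.
  move=> au; have [/cyl_wordP thu _] := theta_maximizes _ _ _ gc au.
  set th := theta g u in thu *.
  set x := past_of_letter (th 0).
  have xu : continues x u by rewrite -thu; exact: continues_past_of_letter.
  have [_ /cyl_wordP vu] := repP xu; set v := rep x u in vu.
  have thv i : (i < N)%N -> th i%:Z = v i%:Z.
    by move: i; apply/eq_word_of; rewrite thu vu.
  (* Only the past chosen for the first letter of [u] is kept; the other terms are nonnegative. *)
  rewrite (bigD1 (th 0))//= -[leLHS]addr0 lerD//; last first.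
    by apply: sumr_ge0 => a _; rewrite mulr_ge0// expR_ge0.
  rewrite -/x /q /weight ifT; last exact/asboolP.
  rewrite -/v.
  have d1 := distortion _ _ _ thv.
  have d2 := birkhoff_cylinder F phi phiB phi_hol N t _ _ thv.
  have d3 := expR_birkhoff_cyl_mass N v.
  rewrite /g birkhoff_tilted.
  set Pth := \sum_(k < N) _ in d1 *; set Pv := \sum_(k < N) _ in d1 d3.
  set sth := birkhoff _ _ _ _ in d2 *; set sv := birkhoff _ _ _ _ in d2 *.
  have d4 : - (b * sth) <= - (b * sv) + b * (C + 2 * B).
    have : b * (sv - sth) <= b * (C + 2 * B).
      by rewrite ler_wpM2l// (le_trans (ler_norm _))// distrC.
    lra.
  apply: (@le_trans _ _ (expR (N%:R * eta + (m + m)%:R * (2 * M) + b * (C + 2 * B))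
     * (expR Pv * expR (- (b * sv))))).
    rewrite -!expRD ler_expR; lra.
  have -> : K = expR (N%:R * eta + (m + m)%:R * (2 * M) + b * (C + 2 * B)) *
      expR (2 * M).
    by rewrite /K expRD.
  by rewrite -!mulrA ler_pM2l ?expR_gt0// mulrA ler_pM2r ?expR_gt0.
rewrite /partition_sum.
apply: (@le_trans _ _
    (\sum_(u : N.-tuple S) \sum_(a : S) K * q (past_of_letter a) u)).
  apply: (le_trans (ler_sum _ main)); rewrite [leRHS](bigID (@admissible S N))/=.
  rewrite lerDl; apply: sumr_ge0 => u _; apply: sumr_ge0 => a _.
  by rewrite mulr_ge0// expR_ge0.
rewrite exchange_big/= mulr_natl -sumr_const.
by apply: ler_sum => a _; rewrite -big_distrr/= ler_wpM2l ?expR_ge0// wZ.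
Qed.

End PartitionSum.


(** * From finite-time bounds to the pressure *)

Lemma limn_esup_le {R : realType} (u : (\bar R)^nat) (l : \bar R) N0 :
  (forall n, (N0 <= n)%N -> (u n <= l)%E) -> (limn_esup u <= l)%E.
Proof.
move=> ul; rewrite /limn_esup limf_esupE.
apply: (@le_trans _ _ (ereal_sup (u @` [set n | (N0 <= n)%N]))).
  by apply: ereal_inf_lbound; exists [set n | (N0 <= n)%N] => //; exists N0.
by apply: ge_ereal_sup => _ [n /= N0n <-]; exact: ul.
Qed.

Theorem theorem8p12 (R : realType) (S : markovShift) (X : metricType R)
  (alpha : R) (F : Sigma S -> X -> X) (phi : Sigma S * X -> R)
  (psi : SigmaM S -> R) (mu : probability (Sigma S) R)
  (mu_ : SigmaM S -> probability (Sigma S) R) (chi : R) :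
  compact [set: X] ->
  0 < alpha -> holder_cocycle F alpha ->
  holder_continuous (@pdist R S X) (@rdist R) phi ->
  holder_continuous (@sdist R S) (@rdist R) (psi \o past) ->
  pressure (psi \o past) = 0%E ->
  (forall x, transfer psi (fun=> 1) x = 1) ->
  shift_invariant mu -> gibbs mu (psi \o past) ->
  unstable_conditionals mu psi mu_ ->
  topologically_transitive (@shiftT S) ->
  weak_unstable_holonomies F ->
  phi_holonomies F phi ->
  0 < chi -> uniform_expansion mu_ phi chi ->
  exists K beta0 : R, [/\ 0 < K, 0 < beta0 &
    forall beta : R, 0 < beta -> beta < beta0 ->
      (pressure_out F (fun p => psi (past p.1) - beta * phi p)%R
       <= (- (beta * (chi - K * beta)))%:E)%E].
Proof.
move=> cX alpha0 Fh phih psih _ _ _ _ [mu_Vu mu_cyl _] _ Fw [C C0 phi_hol] chi0 expansion.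
have [DX pdistD] := @pdist_bounded R X cX S.
have [B B0 phiB] := holder_bounded _ pdistD phih.
have [M M0 psiM] : exists2 M, 0 < M & forall w : Sigma S, `|(psi \o past) w| <= M.
  by apply: (holder_bounded 1 _ psih) => w w'; rewrite sdist_ge0 sdist_le1.
have phi_unif := holder_unif_continuous (@pdist_ge0 R X S) phih.
have psi_unif := holder_unif_continuous (@sdist_ge0 R S) psih.
have phi_cont t : continuous (fun w => phi (w, t)).
  apply: window_continuous => w e e0.
  have [r r0 phi_r] := phi_unif e e0.
  have [n nr] := exists_half_exp_le _ r0.
  exists n => w' ww'; apply: phi_r; rewrite /pdist/= ge_max mdistxx (ltW r0) andbT.
  exact: le_trans (sdist_le _ _ _ ww') nr.
pose D : R := 2 * (C + 2 * B) + B.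
have D0 : 0 < D by rewrite /D; lra.
(* [2 * D ^+ 2] is the quadratic term of the moment bound. The 3 counts three errors b^2 per step:
   the loss [b] in the drift, the distortion of psi, and the terms independent of [n]. The choice of
   beta0 ensures [b * D <= 2^-1]. *)
exists (3 + 2 * D ^+ 2), ((2 * D)^-1); split.
- by rewrite ltr_wpDr// mulr_ge0// sqr_ge0.
- by rewrite invr_gt0 mulr_gt0.
move=> b b0 b_lt.
have bD : b * D <= 2^-1.
  by rewrite -ler_pdivlMr// -invfM ltW.
have b20 : 0 < b ^+ 2 by rewrite exprn_gt0.
have Phi_cont n t : continuous (fun w =>
    birkhoff (skew_product F) (fun p => psi (past p.1) - b * phi p) n (w, t)).
  apply: (continuous_birkhoff cX alpha0 Fh) => e e0.
  have e20 : 0 < e / 2 by rewrite divr_gt0.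
  have e2b0 : 0 < e / 2 / b by rewrite divr_gt0.
  have [r1 r10 psi_r] := psi_unif _ e20.
  have [r2 r20 phi_r] := phi_unif _ e2b0.
  exists (Num.min r1 r2) => [|p q]; first by rewrite lt_min r10.
  rewrite le_min => /andP[pq1 pq2].
  have h1 : `|psi (past p.1) - psi (past q.1)| <= e / 2.
    by apply: psi_r; apply: le_trans pq1; rewrite /pdist le_max lexx.
  have h2 : b * `|phi p - phi q| <= e / 2.
    by rewrite mulrC -ler_pdivlMr//; exact: phi_r.
  rewrite (_ : _ - _ = (psi (past p.1) - psi (past q.1)) - b * (phi p - phi q)); last by ring.
  rewrite (le_trans (ler_normB _ _))// normrM (gtr0_norm b0); lra.
(* The choices of [r], [n1], [n0] and [m] depend on [b] but neither on [n] nor on [t]. *)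
have [r r0 phi_r] := phi_unif b b0.
have [n1 n1r] := exists_half_exp_le _ r0.
have [n0 n0r] := weak_unstable_holonomies_eventually _ Fw _ r0.
have [m psi_m] := holder_window psih _ b20.
(* [Q] collects the terms of the exponent that do not grow with [n]; from [N0] on they are at most
   [n * b^2]. *)
pose Q : R := (m + m)%:R * (2 * M) + b * (C + 2 * B) + 2 * M +
  (n0 + n1)%:R * (b * (B + chi)) + ln #|S|%:R.
pose N0 := (Num.bound (`|Q| / b ^+ 2)).+1.
apply: (@limn_esup_le _ _ _ N0) => n N0n.
apply: ge_ereal_sup => _ [t _ <-]; rewrite lee_fin.
have n_gt0 : (0 < n)%N by exact: leq_trans N0n.
have nR : 0 < n%:R :> R by rewrite ltr0n.
rewrite mulrC ler_pdivrMr//.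
have S0 : 0 < #|S|%:R :> R.
  by rewrite ltr0n; apply/card_gt0P; exists (base_seq S 0).
have moment x := @exp_moment_bound R S X F phi B C phiB phi_hol psi mu_ mu_Vu mu_cyl
  chi b r n0 n1 phi_cont expansion phi_r n0r n1r x t n b (ltW b0) bD (ltW chi0) (ltW b0).
have := @partition_sum_le R S psi M (b ^+ 2) m psiM psi_m X F phi B C phiB phi_hol
  b n t _ (ltW b0) (Phi_cont n t) moment.
set Z := partition_sum _ _.
have Z0 : 0 < Z by exact: partition_sum_gt0.
rewrite -[#|S|%:R]lnK ?posrE// -!expRD -ler_ln ?posrE ?expR_gt0// expRK.
move=> /le_trans; apply.
have Qn : Q <= n%:R * b ^+ 2.
  rewrite -ler_pdivrMr//; apply: (@le_trans _ _ (`|Q| / b ^+ 2)).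
    by rewrite ler_pM2r ?invr_gt0// ler_norm.
  apply: (@le_trans _ _ N0%:R); last by rewrite ler_nat.
  by rewrite -natr1 ler_wpDr// ltW// archi_boundP// divr_ge0// ltW.
rewrite /Q in Qn; rewrite -/D; nra.
Qed.
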